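(* Let $K$ and $\hat M$ be the stiffness matrix and the row-sum lumped mass matrix, respectively, of the (trimmed) B-spline discretization of degrees $\bm p=(p_1,\dots,p_d)$ in dimension $d$ described in the context, with basis functions $\varphi_1,\dots,\varphi_n$ and Rayleigh quotient $\hat R(u_h)=a(u_h,u_h)/\hat b(u_h,u_h)$. Then $$\lambda_1(K,\hat M)\le\min_{1\le i\le n}\hat R(\varphi_i),$$ $$\max_{1\le i\le n}\hat R(\varphi_i)\le\lambda_n(K,\hat M)\le c(\bm p,d)\max_{1\le i\le n}\hat R(\varphi_i),$$ where $c(\bm p,d)\le\prod_{k=1}^d(2p_k+1)$ only depends on the dimension and the spline degree.
   Context: Let $\Omega\subset\mathbb R^d$ be open and connected with Lipschitz boundary $\partial\Omega=\overline{\partial\Omega_D\cup\partial\Omega_N}$, $\partial\Omega_D\cap\partial\Omega_N=\emptyset$, $\partial\Omega_D\ne\emptyset$, embedded in a fictitious domain $\Omega_0\supset\Omega$ with $\partial\Omega_D\subset\partial\Omega_0$. Let $V=\{v\in H^1(\Omega): v|_{\partial\Omega_D}=0\}$. On a background mesh of $\Omega_0$, consider tensor-product B-splines $\varphi_{\bm i}=\varphi_{1,i_1}\cdots\varphi_{d,i_d}$ of degree $p_l\ge1$ in direction $l$, built from open knot vectors (first and last knot repeated $p_l+1$ times) with internal knots of multiplicity between $1$ and $p_l$. These functions are nonnegative, and form a partition of unity before boundary conditions are imposed. The active basis $\Phi=\{\varphi_1,\dots,\varphi_n\}$ consists of those B-splines whose support intersects $\Omega$, with the homogeneous Dirichlet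 condition on $\partial\Omega_D$ strongly imposed, so that $V_h=\operatorname{span}(\Phi)\subset V$. The stiffness matrix is $K=(a(\varphi_i,\varphi_j))_{i,j=1}^n$ with $a(u,v)=\int_\Omega\nabla u\cdot\nabla v$. The row-sum lumped mass matrix is the diagonal positive definite matrix $\hat M=\operatorname{diag}(d_1,\dots,d_n)$ whose entries $d_i$ are the row sums of the mass matrix with entries $\int_\Omega\varphi_i\varphi_j$, the sums being taken before elimination of Dirichlet degrees of freedom, so that, by partition of unity, $d_i=\int_\Omega\varphi_i=\|\varphi_i\|_{L^1(\Omega)}$. The discrete bilinear form $\hat b:V_h\times V_h\to\mathbb R$ is $\hat b(u_h,v_h)=\bm u^\top\hat M\bm v$, where $\bm u,\bm v$ are the coefficient vectors of $u_h,v_h$ in the basis $\Phi$, and $\hat R:V_h\setminus\{0\}\to\mathbb R$ is $\hat R(u_h)=a(u_h,u_h)/\hat b(u_h,u_h)$. The generalized eigenvalues of $(K,\hat M)$ are the $\lambda$ with $K\bm x=\lambda\hat M\bm x$ for some $\bm x\neq0$, ordered as $\lambda_1(K,\hat M)\le\dots\le\lambda_n(K,\hat M)$. *)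

(* Defs.v *)
From HB Require Import structures.
From mathcomp Require Import all_boot all_order all_algebra.
From mathcomp Require Import all_classical all_reals all_analysis.

Set Implicit Arguments.
Unset Strict Implicit.
Unset Printing Implicit Defensive.

Import Order.TTheory GRing.Theory Num.Theory.
Import numFieldTopology.Exports numFieldNormedType.Exports.

Local Open Scope classical_set_scope.
Local Open Scope ring_scope.

Definition row_display : measure_display.
Proof. exact: default_measure_display. Qed.

(* The sigma-algebra on ['rV[R]_d] is generated by the coordinate functions;
   it is the Borel sigma-algebra. *)
Section row_measurable.
Context (R : realType) (d : nat).

Let coordinate (i : 'I_d) (x : 'rV[R]_d) : R := x ord0 i.

Let row_set0 : g_sigma_preimage coordinate set0.
Proof. exact: sigma_algebra0. Qed.

Let row_setC A :
  g_sigma_preimage coordinate A -> g_sigma_preimage coordinate (~` A).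
Proof. exact: sigma_algebraC. Qed.

Let row_bigcup (F : (set 'rV[R]_d)^nat) :
  (forall i, g_sigma_preimage coordinate (F i)) ->
  g_sigma_preimage coordinate (\bigcup_i F i).
Proof. exact: sigma_algebra_bigcup. Qed.

HB.instance Definition _ := @isMeasurable.Build row_display 'rV[R]_d
  (g_sigma_preimage coordinate) row_set0 row_setC row_bigcup.

Lemma measurable_coordinate (i : 'I_d) :
  measurable_fun [set: 'rV[R]_d] (fun x : 'rV[R]_d => x ord0 i).
Proof.
move=> _ Y mY; rewrite setTI; apply: sub_sigma_algebra => /=.
rewrite -bigcup_seq/=; exists i => /=; first by rewrite mem_index_enum.
by exists Y => //; rewrite setTI.
Qed.

Lemma measurable_fun_row d1 (T1 : measurableType d1) (f : T1 -> 'rV[R]_d) :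
  (forall i, measurable_fun [set: T1] (fun t => f t ord0 i)) ->
  measurable_fun [set: T1] f.
Proof.
move=> mf; pose S := [set A : set 'rV[R]_d | measurable (f @^-1` A)].
have sS : sigma_algebra setT S.
  split=> [|A SA|F SF]; rewrite /S /=.
  - by rewrite preimage_set0.
  - by rewrite setTD preimage_setC; exact: measurableC.
  - by rewrite preimage_bigcup; apply: bigcupT_measurable.
suff sub : g_sigma_preimage coordinate `<=` S.
  by move=> _ Y mY; rewrite setTI; exact: sub.
apply: smallest_sub => // A.
rewrite -bigcup_seq/= => -[i _ [Y mY <-]]; rewrite /S /= setTI.
by have := mf i measurableT Y mY; rewrite setTI.
Qed.

End row_measurable.

Section lebesgue_row.
Context (R : realType).

Definition row_cons d (tx : measurableTypeR R * 'rV[R]_d) : 'rV[R]_d.+1 :=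
  \row_i oapp (fun j => tx.2 ord0 j) tx.1 (unlift ord0 i).

Lemma measurable_row_cons d : measurable_fun setT (@row_cons d).
Proof.
apply: measurable_fun_row => i; case: (unliftP ord0 i) => [j|] ->.
- rewrite (_ : (fun t => _) = (fun x : 'rV[R]_d => x ord0 j) \o snd).
    by apply: measurableT_comp => //; exact: measurable_coordinate.
  by apply/funext => t /=; rewrite mxE liftK.
- rewrite (_ : (fun t => _) = fst) //.
  by apply/funext => t /=; rewrite mxE unlift_none.
Qed.

Definition row_uncons d (x : 'rV[R]_d.+1) : measurableTypeR R * 'rV[R]_d :=
  (x ord0 ord0, \row_j x ord0 (lift ord0 j)).

Lemma row_consK d : cancel (@row_cons d) (@row_uncons d).
Proof.
move=> [t x]; rewrite /row_uncons; congr pair; first by rewrite mxE unlift_none.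
by apply/rowP => j; rewrite !mxE liftK.
Qed.

Lemma measurable_row_uncons d : measurable_fun setT (@row_uncons d).
Proof.
apply: measurable_fun_pair; first exact: measurable_coordinate.
apply: measurable_fun_row => j.
rewrite (_ : (fun t => _) = (fun x : 'rV[R]_d.+1 => x ord0 (lift ord0 j))).
  exact: measurable_coordinate.
by apply/funext => x; rewrite mxE.
Qed.

Section step.
Context d (mu : {sigma_finite_measure set 'rV[R]_d -> \bar R}).

Definition lebesgue_row_step : set 'rV[R]_d.+1 -> \bar R :=
  pushforward (@lebesgue_measure R \x mu)%E (@row_cons d).

Let step0 : lebesgue_row_step set0 = 0%E.
Proof. by rewrite /lebesgue_row_step /pushforward preimage_set0 measure0. Qed.

Let step_ge0 A : (0 <= lebesgue_row_step A)%E.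
Proof. by rewrite /lebesgue_row_step /pushforward; exact: measure_ge0. Qed.

Let step_sigma_additive : semi_sigma_additive lebesgue_row_step.
Proof.
move=> F mF tF mUF; rewrite /lebesgue_row_step /pushforward preimage_bigcup.
have mpre A : measurable A -> measurable (@row_cons d @^-1` A).
  by move=> mA; rewrite -[X in measurable X]setTI; exact: measurable_row_cons.
apply: measure_semi_sigma_additive.
- by move=> n; exact: mpre.
- apply/trivIsetP => /= i j _ _ ij; rewrite -preimage_setI.
  by move/trivIsetP : tF => /(_ _ _ _ _ ij) ->//; rewrite preimage_set0.
- by rewrite -preimage_bigcup; exact: mpre.
Qed.

HB.instance Definition _ := isMeasure.Build _ _ _
  lebesgue_row_step step0 step_ge0 step_sigma_additive.

Let step_sigma_finite : sigma_finite setT lebesgue_row_step.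
Proof.
have /sigma_finiteP[F [FT ndF Foo]] := sigma_finiteT (@lebesgue_measure R).
have /sigma_finiteP[G [GT ndG Goo]] := sigma_finiteT mu.
exists (fun k => @row_uncons d @^-1` (F k `*` G k)).
  rewrite -preimage_bigcup -[LHS](@preimage_setT _ _ (@row_uncons d)).
  congr (_ @^-1` _); rewrite -setXTT FT GT predeqE => -[x y]; split.
    move=> [/= [n _ Fnx] [k _ Gky]]; exists (maxn n k) => //; split.
    - by move: x Fnx; exact/subsetPset/ndF/leq_maxl.
    - by move: y Gky; exact/subsetPset/ndG/leq_maxr.
  by move=> [n _ []/= ? ?]; split; exists n.
move=> k; have [mF Fk] := Foo k; have [mG Gk] := Goo k; split.
  rewrite -[X in measurable X]setTI; apply: measurable_row_uncons => //.
  exact: measurableX.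
rewrite /lebesgue_row_step /pushforward -comp_preimage.
rewrite (_ : _ \o _ = id); last by apply/funext => tx /=; rewrite row_consK.
by rewrite preimage_id product_measure1E// lte_mul_pinfty// ge0_fin_numE.
Qed.

HB.instance Definition _ := Measure_isSigmaFinite.Build _ _ _
  lebesgue_row_step step_sigma_finite.

End step.

Fixpoint lebesgue_row d : {sigma_finite_measure set 'rV[R]_d -> \bar R} :=
  if d is d'.+1 then lebesgue_row_step (lebesgue_row d')
  else dirac (0 : 'rV[R]_0).

Lemma lebesgue_row_box d (A : 'I_d -> set (measurableTypeR R)) :
  (forall i, measurable (A i)) ->
  lebesgue_row d [set x | forall i, A i (x ord0 i)] =
  (\prod_(i < d) lebesgue_measure (A i))%E.
Proof.
elim: d A => [|d IH] A mA /=.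
  rewrite big_ord0 diracE mem_set//= => -[].
  by [].
rewrite big_ord_recl -(IH (fun i => A (lift ord0 i)))//.
have mB : measurable [set x : 'rV[R]_d | forall i, A (lift ord0 i) (x ord0 i)].
  rewrite (_ : [set _ | _] = \bigcap_(i in [set: 'I_d])
      ((fun x : 'rV[R]_d => x ord0 i) @^-1` A (lift ord0 i))); last first.
    by apply/seteqP; split=> [x /= Ax i _|x /= Ax i]; [exact: Ax|exact: Ax].
  apply: fin_bigcap_measurable => // i _.
  rewrite -[X in measurable X]setTI.
  by apply: (@measurable_coordinate R d i); [|exact: mA].
rewrite /lebesgue_row_step /pushforward -product_measure1E//.
congr (_ _); apply/seteqP; split=> -[t x] /=.
  move=> Ax; split=> [|i]; first by have := Ax ord0; rewrite mxE unlift_none.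
  by have := Ax (lift ord0 i); rewrite mxE liftK.
by move=> [At Ax] i; rewrite mxE; case: (unliftP ord0 i) => [j|] ->.
Qed.

End lebesgue_row.

Section domains.
Context (R : realType) (d : nat).
Implicit Types (Omega : set 'rV[R]_d).

Definition boundary Omega : set 'rV[R]_d := closure Omega `\` interior Omega.

(* Near each boundary point and in suitable Cartesian coordinates
   [y = x *m Q], the set is the strict epigraph of a Lipschitz function of all
   coordinates but the [i]-th. *)
Definition lipschitz_boundary Omega :=
  forall x, boundary Omega x ->
  exists (Q : 'M[R]_d) (i : 'I_d) (g : 'rV[R]_d.-1 -> R),
    [/\ Q *m Q^T = 1%:M, lipschitz g
      & \forall z \near x,
          Omega z <-> g (col' i (z *m Q)) < (z *m Q) ord0 i].

End domains.

Section bsplines.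
Context (R : realType).
Implicit Types (p i : nat) (xi : seq R).

Definition open_knot_vector p xi :=
  [/\ sorted <=%R xi, head 0 xi < last 0 xi,
      count_mem (head 0 xi) xi = p.+1, count_mem (last 0 xi) xi = p.+1
    & forall t, head 0 xi < t < last 0 xi -> (count_mem t xi <= p)%N].

Definition nb_bsplines p xi : nat := size xi - p.+1.

(* Cox-de Boor recursion, with the convention 0/0 = 0. The last nonempty knot
   span is closed on the right, so that the B-splines are continuous on the
   closed interval spanned by the knots and sum to 1 on it. *)
Fixpoint bspline xi p i (x : R) : R :=
  if p is q.+1 then
    (x - xi`_i) / (xi`_(i + p) - xi`_i) * bspline xi q i x
    + (xi`_(i + p).+1 - x) / (xi`_(i + p).+1 - xi`_i.+1)
      * bspline xi q i.+1 x
  else ((xi`_i <= x < xi`_i.+1)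
        || [&& xi`_i < xi`_i.+1, xi`_i.+1 == last 0 xi & x == last 0 xi])%:R.

End bsplines.

Section discretization.
Context (R : realType) (d : nat) (p : 'I_d -> nat) (xi : 'I_d -> seq R).

Definition fictitious_domain : set 'rV[R]_d :=
  [set x | forall l, head 0 (xi l) < x ord0 l < last 0 (xi l)].

Definition multi_index : finType :=
  {dffun forall l : 'I_d, 'I_(nb_bsplines (p l) (xi l))}.

Definition tensor_bspline (i : multi_index) (x : 'rV[R]_d) : R :=
  \prod_(l < d) bspline (xi l) (p l) (i l) (x ord0 l).

Context (Omega GammaD : set 'rV[R]_d).

Definition grad (u : 'rV[R]_d -> R) (x : 'rV[R]_d) : 'rV[R]_d :=
  \row_l 'D_(delta_mx ord0 l) u x.

(* Splines are continuous and piecewise polynomial, so their weak gradient is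
   the classical one, which exists off the mesh lines, a null set. *)
Definition energy (u v : 'rV[R]_d -> R) : R :=
  \int[lebesgue_row R d]_(x in Omega) (grad u x *m (grad v x)^T) ord0 ord0.

Definition touches (i : multi_index) : Prop :=
  closure [set x | tensor_bspline i x != 0] `&` Omega !=set0.

Definition active (i : multi_index) : Prop :=
  touches i /\ forall x, GammaD x -> tensor_bspline i x = 0.

Definition nb_active : nat := #|[set i : multi_index | `[< active i >]]%SET|.

Definition active_index (k : 'I_nb_active) : multi_index := enum_val k.

Definition phi (k : 'I_nb_active) : 'rV[R]_d -> R :=
  tensor_bspline (active_index k).

Definition stiffness : 'M[R]_nb_active := \matrix_(k, m) energy (phi k) (phi m).

(* The row sums range over all B-splines meeting [Omega], including those
   eliminated by the Dirichlet condition. *)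
Definition lumped_entry (k : 'I_nb_active) : R :=
  \sum_(j : multi_index | `[< touches j >])
    \int[lebesgue_row R d]_(x in Omega) (phi k x * tensor_bspline j x).

Definition lumped_mass : 'M[R]_nb_active := diag_mx (\row_k lumped_entry k).

(* [V_h] is parametrized by the coefficient vectors in the basis [phi]. *)
Definition spline (u : 'cV[R]_nb_active) (x : 'rV[R]_d) : R :=
  \sum_k u k ord0 * phi k x.

Definition bhat (u v : 'cV[R]_nb_active) : R :=
  (u^T *m lumped_mass *m v) ord0 ord0.

Definition Rhat (u : 'cV[R]_nb_active) : R :=
  energy (spline u) (spline u) / bhat u u.

Definition Rhat_basis (k : 'I_nb_active) : R := Rhat (delta_mx k ord0).

End discretization.

Section generalized_eigenvalues.
Context (R : realType) (n : nat).

Definition gen_eigenvalue (A B : 'M[R]_n) (mu : R) :=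
  exists2 x : 'cV[R]_n, x != 0 & A *m x = mu *: (B *m x).

(* Nondecreasing enumeration of the generalized eigenvalues, each repeated
   according to the dimension of [{x | A x = mu B x}]. *)
Definition ordered_gen_eigenvalues (A B : 'M[R]_n) (lam : n.-tuple R) :=
  [/\ sorted <=%R lam,
      forall mu, mu \in lam <-> gen_eigenvalue A B mu
    & forall mu, mu \in lam -> count_mem mu lam = (n - \rank (A - mu *: B)%R)%N].

End generalized_eigenvalues.

(* Main.v *)
(* Conjugating K by the inverse square root of the lumped mass D gives a real
   symmetric matrix with diagonal entries K_kk / D_k = Rhat(phi_k), and the
   diagonal of a symmetric matrix lies between its extreme eigenvalues; this
   gives the lower bounds. For the upper bound, pointwise Cauchy-Schwarz gives
   2 s t K_ij <= s^2 K_ii + t^2 K_jj, and K_ij vanishes unless the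
   multi-indices of phi_i and phi_j differ by at most p_l in every direction l,
   so that each row has at most prod_l (2 p_l + 1) nonzero entries. Hence
   x^T K x <= c sum_i K_ii x_i^2 <= c (max_i Rhat(phi_i)) x^T D x, which is
   evaluated at an eigenvector of the largest eigenvalue. *)

Require Import Defs.
From HB Require Import structures.
From mathcomp Require Import complex.
From mathcomp Require Import all_boot all_order all_algebra.
From mathcomp Require Import all_classical all_reals all_analysis.
From mathcomp Require Import measurable_realfun ring lra zify.

Set Implicit Arguments.
Unset Strict Implicit.
Unset Printing Implicit Defensive.

Import Order.TTheory GRing.Theory Num.Theory.
Import numFieldTopology.Exports numFieldNormedType.Exports.

Local Open Scope classical_set_scope.
Local Open Scope ring_scope.

(** * Linear algebra: spectra of symmetric matrices and of pencils with a diagonal mass *)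

Lemma mxrank_diag (F : fieldType) n (d : 'rV[F]_n) :
  \rank (diag_mx d) = #|[pred i | d ord0 i != 0]|.
Proof.
pose S := [pred i | d ord0 i != 0].
(* [B] keeps the unit rows at the nonzero entries of [d]; it has full row rank and the same row
   space as the diagonal matrix. *)
pose B : 'M[F]_(#|S|, n) := rowsub (@enum_val _ S) 1%:M.
have rowB s : row s B = delta_mx 0 (enum_val s) by rewrite row_rowsub row1.
have freeB : row_free B.
  apply/row_freeP; exists B^T; apply/matrixP => s t; rewrite !mxE.
  rewrite (bigD1 (enum_val s)) //= big1 ?addr0 => [|j /negPf js]; last first.
    by rewrite !mxE [_ == j]eq_sym js mul0r.
  by rewrite !mxE eqxx mul1r (inj_eq enum_val_inj) [t == s]eq_sym.
rewrite -(eqP freeB); apply/eqmx_rank/andP; split; apply/row_subP => i.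
  rewrite row_diag_mx; have [/eqP ->|di] := boolP (d ord0 i == 0).
    by rewrite scale0r sub0mx.
  rewrite scalemx_sub //.
  have iS : i \in S by [].
  by rewrite -(enum_rankK_in iS iS) -rowB row_sub.
have := enum_valP i; rewrite inE => di.
rewrite rowB -[delta_mx _ _]scale1r -(mulVf di) -scalerA -row_diag_mx.
by rewrite scalemx_sub ?row_sub.
Qed.

Lemma mem_head_last_sorted (disp : Order.disp_t) (T : orderType disp) (x0 : T)
    s x :
  sorted <=%O s -> x \in s -> (head x0 s <= x <= last x0 s)%O.
Proof.
move=> ss xs; rewrite -nth0 -nth_last -(nth_index x0 xs).
have ixs : (index x s < size s)%N by rewrite index_mem.
have ltP : (0 < size s)%N by apply: leq_ltn_trans ixs.
have le0 := sorted_leq_nth le_trans le_refl x0 ss.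
by rewrite !le0 ?inE ?ltn_predL ?leq0n // -ltnS prednK.
Qed.

Section symmetric_spectrum.
Local Open Scope complex_scope.

(** Over the complex numbers [A] is hermitian, hence unitarily diagonalizable with real eigenvalues.
    The rank of the shifted diagonal matrix counts multiplicities, and [A k k] is the average of the
    eigenvalues with weights [|P i k| ^+ 2], which sum to 1. *)
Lemma symmetric_spectrum (R : rcfType) n (A : 'M[R]_n) : A^T = A ->
  exists lam : n.-tuple R,
    [/\ sorted <=%R lam,
        forall mu, count_mem mu lam = (n - \rank (A - mu%:M)%R)%N
      & forall k, head 0 lam <= A k k <= last 0 lam].
Proof.
move=> Asym; pose toC := real_complex R.
pose AC := map_mx toC A.
have Aherm : AC \is hermsymmx.
  apply: realsym_hermsym.
    by apply/is_hermitianmxP; rewrite scale1r map_mx_id // map_trmx Asym.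
  by apply/mxOverP => i j; rewrite mxE complex_real.
have /orthomx_spectralP := hermitian_normalmx Aherm.
have := hermitian_spectral_diag_real Aherm; have := spectral_unitarymx AC.
move: (spectralmx AC) (spectral_diag AC) => P sp uP /mxOverP spR AE.
pose mu i := complex.Re (sp ord0 i).
have spE i : sp ord0 i = (mu i)%:C.
  by rewrite /mu RRe_real.
pose lam := sort_tuple <=%R [tuple mu i | i < n].
exists lam; split.
- exact: sort_le_sorted.
- move=> x; rewrite (permP (permEl (perm_sort _ _))) count_map.
  rewrite -(mxrank_map toC) map_mxB map_scalar_mx -/AC AE.
  have -> : invmx P *m diag_mx sp *m P - (toC x)%:M =
      invmx P *m diag_mx (sp - const_mx (toC x)) *m P.
    rewrite raddfB /= mulmxBr mulmxBl diag_const_mx; congr (_ - _).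
    by rewrite mul_mx_scalar -scalemxAl mulVmx ?unitarymx_unit // scalemx1.
  rewrite mxrankMfree ?row_free_unit ?unitarymx_unit //.
  rewrite eqmxMfull ?row_full_unit ?unitmx_inv ?unitarymx_unit //.
  rewrite mxrank_diag -[X in (X - _)%N]card_ord.
  rewrite -(cardC [pred i | (sp - const_mx (toC x)) ord0 i != 0]) addKn.
  rewrite cardE size_filter -enumT -/(enum 'I_n).
  apply: eq_count => i; rewrite !inE !mxE spE subr_eq0 negbK.
  by rewrite /toC (inj_eq (fmorph_inj _)).
- move=> k.
  have bnd i : head 0 lam <= mu i <= last 0 lam.
    apply: mem_head_last_sorted; first exact: sort_le_sorted.
    by rewrite mem_sort map_f ?mem_enum.
  have P1 : \sum_i `|P i k| ^+ 2 = 1.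
    have := mulVmx (unitarymx_unit uP).
    rewrite invmx_unitary // => /matrixP/(_ k k).
    rewrite !mxE eqxx mulr1n => <-; apply: eq_bigr => i _.
    by rewrite !mxE mulrC normCK.
  have Akk : toC (A k k) = \sum_i (mu i)%:C * `|P i k| ^+ 2.
    have /matrixP/(_ k k) := AE; rewrite invmx_unitary // !mxE => ->.
    apply: eq_bigr => i _; rewrite mul_mx_diag !mxE spE normCK.
    by rewrite [_ * (mu i)%:C]mulrC -mulrA [_ * P i k]mulrC.
  rewrite -!lecR [(A k k)%:C]Akk -[(head _ _)%:C]mulr1 -[(last _ _)%:C]mulr1.
  rewrite -P1 !mulr_sumr.
  by apply/andP; split; apply: ler_sum => i _; have /andP[b1 b2] := bnd i;
     rewrite ler_wpM2r ?lecR // exprn_ge0.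
Qed.

End symmetric_spectrum.

(** Symmetry lets transposition turn an eigenvector into a left kernel vector of [K - mu *: M],
    which is what a rank defect provides. *)
Lemma gen_eigenvalue_rank (R : realType) n (K M : 'M[R]_n) (mu : R) :
  K^T = K -> M^T = M ->
  gen_eigenvalue K M mu <-> (\rank (K - mu *: M)%R < n)%N.
Proof.
move=> Ksym Msym; pose B := K - mu *: M.
have Bsym : B^T = B by rewrite /B linearB linearZ /= Ksym Msym.
have kerB (x : 'cV_n) : K *m x = mu *: (M *m x) <-> x^T *m B = 0.
  rewrite -Bsym -trmx_mul mulmxBl -scalemxAl.
  split=> [->|/(congr1 trmx)]; first by rewrite subrr trmx0.
  by rewrite trmxK trmx0 => /subr0_eq.
rewrite ltn_neqAle rank_leq_row andbT -[_ == n]/(row_free B).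
split=> [[x x0 /kerB xB]|freeB].
  apply: contra x0 => freeB; rewrite -[x]trmxK.
  by move: xB => /eqP; rewrite mulmx_free_eq0 // => /eqP ->; rewrite trmx0.
have /rowV0Pn[v /sub_kermxP vB v0] : kermx B != 0 by rewrite kermx_eq0.
exists v^T; last by apply/kerB; rewrite trmxK.
by apply: contra v0 => /eqP/(congr1 trmx); rewrite trmxK trmx0 => ->.
Qed.

(** Let [S = diag_mx s] be the inverse square root of the mass [M]. Then
    [S (K - mu M) S = S K S - mu I] has the rank of [K - mu M], so multiplicities are those of the
    symmetric matrix [S K S]. *)
Lemma gen_symmetric_spectrum (R : realType) n (K : 'M[R]_n) (m : 'rV[R]_n) :
  K^T = K -> (forall k, 0 < m ord0 k) ->
  exists2 lam : n.-tuple R, ordered_gen_eigenvalues K (diag_mx m) lam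
    & forall k, head 0 lam <= K k k / m ord0 k <= last 0 lam.
Proof.
move=> Ksym m0; pose s : 'rV[R]_n := \row_k (Num.sqrt (m ord0 k))^-1.
have s0 k : s ord0 k != 0 by rewrite mxE invr_eq0 gt_eqF ?sqrtr_gt0.
have s2 k : s ord0 k ^+ 2 = (m ord0 k)^-1 by rewrite mxE exprVn sqr_sqrtr ?ltW.
have uS : diag_mx s \in unitmx.
  by rewrite unitmxE det_diag unitfE; apply/prodf_neq0 => i _; exact: s0.
have SMS : diag_mx s *m diag_mx m *m diag_mx s = 1%:M.
  rewrite !mulmx_diag; apply/matrixP => i j; rewrite !mxE; case: eqP => //= _.
  by rewrite mulrAC -expr2 exprVn sqr_sqrtr ?ltW // mulVf ?gt_eqF.
have [|lam [lam_sorted lam_count lam_bnd]] :=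
    @symmetric_spectrum R n (diag_mx s *m K *m diag_mx s).
  by rewrite !trmx_mul tr_diag_mx Ksym mulmxA.
have countE mu : count_mem mu lam = (n - \rank (K - mu *: diag_mx m)%R)%N.
  rewrite lam_count -[mu%:M]scalemx1 -SMS -!mulmxA scalemxAr -mulmxBr.
  rewrite scalemxAl -mulmxBl.
  by rewrite eqmxMfull ?row_full_unit // mxrankMfree ?row_free_unit.
exists lam; last first.
  move=> k; have := lam_bnd k; rewrite mul_mx_diag mxE mul_diag_mx mxE.
  by rewrite mulrAC -expr2 s2 mulrC.
split => // [mu].
rewrite gen_eigenvalue_rank ?tr_diag_mx // -subn_gt0 -countE.
by rewrite -has_count has_pred1.
Qed.

(** Nonnegativity of the quadratic form is asked only on combinations of two basis vectors; this
    bounds each mixed term by two diagonal ones. *)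
Lemma gen_eigenvalue_le (R : realType) n (K : 'M[R]_n) (m : 'rV[R]_n)
    (c : nat) (r mu : R) :
  K^T = K ->
  (forall i j s t,
    0 <= s ^+ 2 * K i i + (s * t * K i j) *+ 2 + t ^+ 2 * K j j) ->
  (forall i, (#|[pred j | K i j != 0%R]| <= c)%N) ->
  (forall k, 0 < m ord0 k) -> (forall k, K k k <= r * m ord0 k) ->
  gen_eigenvalue K (diag_mx m) mu -> mu <= c%:R * r.
Proof.
move=> Ksym K0 Kc m0 Kr [x x0 Kx].
have Kdiag k : 0 <= K k k.
  have := K0 k k 1 0.
  by rewrite !expr2 !(mul1r, mul0r, mulr0, mulr1, mul0rn, addr0).
have [k0 xk0] : exists k, x k ord0 != 0.
  by apply/cV0Pn.
have xMx : 0 < \sum_i m ord0 i * x i ord0 ^+ 2.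
  rewrite (bigD1 k0) //= ltr_pwDl //.
    by rewrite mulr_gt0 // lt_neqAle eq_sym sqrf_eq0 xk0 sqr_ge0.
  by apply: sumr_ge0 => i _; rewrite mulr_ge0 ?sqr_ge0 ?ltW.
rewrite -(ler_pM2r xMx).
(* Pairing the eigenvector equation with [x] gives [mu x^T M x = x^T K x]. *)
have -> : mu * (\sum_i m ord0 i * x i ord0 ^+ 2) =
    \sum_i \sum_j x i ord0 * x j ord0 * K i j.
  rewrite mulr_sumr; apply: eq_bigr => i _.
  have /matrixP/(_ i ord0) := Kx; rewrite mul_diag_mx !mxE => Kxi.
  rewrite expr2 !mulrA -[mu * _ * _]mulrA -Kxi mulr_suml.
  by apply: eq_bigr => j _; ring.
pose T i := x i ord0 ^+ 2 * K i i.
have T0 i : 0 <= T i by rewrite mulr_ge0 ?sqr_ge0.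
have step i j : x i ord0 * x j ord0 * K i j <= (T i + T j) / 2 *+ (K i j != 0).
  have [->|_] := eqVneq (K i j) 0; first by rewrite mulr0 mulr0n.
  rewrite mulr1n ler_pdivlMr //.
  (* The minus sign turns nonnegativity into an upper bound on the mixed term. *)
  by have := K0 i j (x i ord0) (- x j ord0); rewrite /T; lra.
have rows : \sum_i \sum_j T i *+ (K i j != 0) <= c%:R * \sum_i T i.
  rewrite mulr_sumr; apply: ler_sum => i _.
  rewrite (eq_bigr (fun j => if K i j != 0 then T i else 0)); last first.
    by move=> j _; case: (K i j != 0).
  rewrite -big_mkcond sumr_const mulr_natl.
  exact: ler_wpMn2l (T0 i) _ _ (Kc i).
(* The nonzero pattern of [K] is symmetric, so the count per row also serves for columns. *)
have cols : \sum_i \sum_j T j *+ (K i j != 0) =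
    \sum_i \sum_j T i *+ (K i j != 0).
  rewrite exchange_big; apply: eq_bigr => i _; apply: eq_bigr => j _.
  by rewrite -[in LHS]Ksym mxE.
apply: (@le_trans _ _ (c%:R * \sum_i T i)).
  apply: (@le_trans _ _ (\sum_i \sum_j (T i + T j) / 2 *+ (K i j != 0))).
    by apply: ler_sum => i _; apply: ler_sum => j _; exact: step.
  rewrite (eq_bigr (fun i => (\sum_j T i *+ (K i j != 0)) / 2
      + (\sum_j T j *+ (K i j != 0)) / 2)); last first.
    move=> i _; rewrite -mulrDl -big_split mulr_suml; apply: eq_bigr => j _.
    by rewrite /= -mulrnDl mulrnAl.
  rewrite big_split /= -!mulr_suml cols.
  by apply: le_trans rows; rewrite -splitr.
rewrite -mulrA ler_wpM2l // [leRHS]mulr_sumr; apply: ler_sum => i _.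
by rewrite /T [leLHS]mulrC [leRHS]mulrA ler_wpM2r ?sqr_ge0.
Qed.

(** * Univariate B-splines: support, bounds, right continuity and derivative *)

Section bspline_theory.
Context (R : realType) (xi : seq R).
Implicit Types (p i : nat) (x y : R).

(** The indices are arranged so that both terms have knots [j] and [(j + p).+1] as ends, with
    [j = i] and [j = i.+1]. *)
Lemma bsplineS p i x : bspline xi p.+1 i x =
  (x - xi`_i) / (xi`_(i + p).+1 - xi`_i) * bspline xi p i x
  + (xi`_(i.+1 + p).+1 - x) / (xi`_(i.+1 + p).+1 - xi`_i.+1)
    * bspline xi p i.+1 x.
Proof. by rewrite /= addnS addSn. Qed.

(* The recursion of [bspline] differentiated term by term, which gives its
   derivative off the knots. *)
Fixpoint dbspline p i x : R :=
  if p is q.+1 then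
    ((xi`_(i + q).+1 - xi`_i)^-1 * bspline xi q i x
      + (x - xi`_i) / (xi`_(i + q).+1 - xi`_i) * dbspline q i x)
    + (- (xi`_(i.+1 + q).+1 - xi`_i.+1)^-1 * bspline xi q i.+1 x
      + (xi`_(i.+1 + q).+1 - x) / (xi`_(i.+1 + q).+1 - xi`_i.+1)
        * dbspline q i.+1 x)
  else 0.

Lemma measurable_bspline p i : measurable_fun setT (bspline xi p i).
Proof.
elim: p i => [|p IH] i.
  pose A : set R := `[xi`_i, xi`_i.+1[%classic `|`
    (if (xi`_i < xi`_i.+1) && (xi`_i.+1 == last 0 xi) then [set last 0 xi]
     else set0).
  rewrite (_ : bspline xi 0 i = \1_A).
    apply: measurable_indic; apply: measurableU => //; first by case: ifP.
  apply/funext => x; rewrite /= indicE; congr (nat_of_bool _)%:R.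
  rewrite /A in_setU mem_setE in_itv /= andbA; congr (_ || _).
  case: ifP => _; last by rewrite in_set0.
  by rewrite in_set1.
rewrite (_ : bspline xi p.+1 i = fun x =>
  (x - xi`_i) / (xi`_(i + p).+1 - xi`_i) * bspline xi p i x
  + (xi`_(i.+1 + p).+1 - x) / (xi`_(i.+1 + p).+1 - xi`_i.+1)
    * bspline xi p i.+1 x); last by apply/funext => x; rewrite bsplineS.
apply: measurable_funD; apply: measurable_funM => //;
  apply: measurable_funM => //;
  exact: measurable_funB.
Qed.

Lemma measurable_dbspline p i : measurable_fun setT (dbspline p i).
Proof.
elim: p i => [|p IH] i /=; first exact: measurable_cst.
have mB := measurable_bspline.
apply: measurable_funD; (apply: measurable_funD; apply: measurable_funM => //);
  by apply: measurable_funM => //; exact: measurable_funB.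
Qed.

Hypothesis xi_sorted : sorted <=%R xi.

Lemma knot_le i j : (i <= j)%N -> (j < size xi)%N -> xi`_i <= xi`_j.
Proof.
move=> ij jn; apply: (sorted_leq_nth le_trans le_refl) => //.
by rewrite inE (leq_ltn_trans ij).
Qed.

(** The index condition says that the knot of index [(i + p).+1] exists, so no default value of
    [nth] enters. The interval is closed because the last nonempty span contains its right end. *)
Lemma bspline_support p i x : (i + p < (size xi).-1)%N ->
  bspline xi p i x != 0 -> xi`_i <= x <= xi`_(i + p).+1.
Proof.
elim: p i => [|p IH] i.
  rewrite addn0 => ip /=; rewrite pnatr_eq0 eqb0 negbK.
  case/orP => [/andP[-> /ltW ->] //|/and3P[ii1 /eqP i1l /eqP ->]].
  by rewrite -i1l lexx ltW.
rewrite addnS -addSn => ip; rewrite bsplineS.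
have ip' : (i.+1 + p < size xi)%N by rewrite (leq_trans ip) ?leq_pred.
have ip1 : ((i.+1 + p).+1 < size xi)%N by move: ip; case: (size xi).
have [b1|b1] := eqVneq (bspline xi p i x) 0; last first.
  move=> _; have /andP[ix xip] := IH i (ltnW ip) b1.
  rewrite ix (le_trans xip) //; apply: knot_le => //.
have [b2|b2] := eqVneq (bspline xi p i.+1 x) 0.
  by rewrite b1 b2 !mulr0 addr0 eqxx.
move=> _; have /andP[ix xip] := IH i.+1 ip b2.
by rewrite xip andbT (le_trans _ ix) // knot_le //
    (leq_ltn_trans _ ip') // leq_addr.
Qed.

Lemma dbspline_support p i x : (i + p < (size xi).-1)%N ->
  dbspline p i x != 0 -> xi`_i <= x <= xi`_(i + p).+1.
Proof.
elim: p i => [|p IH] i; first by rewrite /= eqxx.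
rewrite addnS -addSn => ip /=.
have ip' : (i.+1 + p < size xi)%N by rewrite (leq_trans ip) ?leq_pred.
have ip1 : ((i.+1 + p).+1 < size xi)%N by move: ip; case: (size xi).
(* A point outside the supports of both lower-degree splines makes all four terms of the recursion
   vanish. *)
have [/andP[ix xip]|] := boolP (xi`_i <= x <= xi`_(i + p).+1).
  by move=> _; rewrite ix (le_trans xip) //; apply: knot_le.
have [/andP[ix xip] _ _|n2 n1] := boolP (xi`_i.+1 <= x <= xi`_(i.+1 + p).+1).
  by rewrite xip andbT (le_trans _ ix) // knot_le //
    (leq_ltn_trans _ ip') // leq_addr.
have -> : bspline xi p i x = 0.
  by apply/eqP/negPn; apply: contra n1 => /bspline_support; apply; exact: ltnW.
have -> : bspline xi p i.+1 x = 0.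
  by apply/eqP/negPn; apply: contra n2 => /bspline_support; apply.
have -> : dbspline p i x = 0.
  by apply/eqP/negPn; apply: contra n1 => /IH; apply; exact: ltnW.
have -> : dbspline p i.+1 x = 0.
  by apply/eqP/negPn; apply: contra n2 => /IH; apply.
by rewrite !mulr0 !addr0 eqxx.
Qed.

(* These are the weights that the Cox-de Boor recursion puts on a B-spline
   supported in [a, b]; they vanish when [a = b] since x / 0 = 0. *)
Lemma weights_bound (a b x : R) : a <= x <= b ->
  (0 <= (x - a) / (b - a) <= 1) /\ (0 <= (b - x) / (b - a) <= 1).
Proof.
move=> /andP[ax xb].
have [->|ab] := eqVneq a b; first by rewrite subrr invr0 !mulr0 lexx ler01.
have {}ab : 0 < b - a by rewrite subr_gt0 lt_neqAle ab (le_trans ax).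
by split; apply/andP; split; rewrite ?divr_ge0 ?ler_pdivrMr //; lra.
Qed.

(** Where a lower-degree spline is nonzero its weight lies in [0, 1], so each degree at most doubles
    the bound. This crude constant serves for integrability. *)
Lemma bspline_bound p i x : (i + p < (size xi).-1)%N ->
  0 <= bspline xi p i x <= 2 ^+ p.
Proof.
elim: p i => [|p IH] i ip; first by rewrite /= ler0n expr0 lern1 leq_b1.
rewrite bsplineS exprS mulr_natl mulr2n; move: ip; rewrite addnS -addSn => ip.
have /andP[b10 b1p] := IH i (ltnW ip); have /andP[b20 b2p] := IH i.+1 ip.
set u := _ * bspline xi p i x; set v := _ * bspline xi p i.+1 x.
have /andP[u0 u1] : 0 <= u <= 2 ^+ p.
  have [b0|] := eqVneq (bspline xi p i x) 0.
    by rewrite /u b0 mulr0 lexx exprn_ge0.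
  move=> /(bspline_support (ltnW ip))/weights_bound[/andP[w0 w1] _].
  by rewrite mulr_ge0 //= (le_trans _ b1p) // ler_piMl.
have /andP[v0 v1] : 0 <= v <= 2 ^+ p.
  have [b0|] := eqVneq (bspline xi p i.+1 x) 0.
    by rewrite /v b0 mulr0 lexx exprn_ge0.
  move=> /(bspline_support ip)/weights_bound[_ /andP[w0 w1]].
  by rewrite mulr_ge0 //= (le_trans _ b2p) // ler_piMl.
by rewrite addr_ge0 //= lerD.
Qed.

Lemma dbspline_bound p i : (i + p < (size xi).-1)%N ->
  exists M, forall x, `|dbspline p i x| <= M.
Proof.
elim: p i => [|p IH] i; first by exists 0 => x; rewrite normr0.
rewrite addnS -addSn => ip.
have [M1 b1] := IH i (ltnW ip); have [M2 b2] := IH i.+1 ip.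
exists (`|(xi`_(i + p).+1 - xi`_i)^-1| * 2 ^+ p + M1
  + (`|(xi`_(i.+1 + p).+1 - xi`_i.+1)^-1| * 2 ^+ p + M2)) => x /=.
have nb j : (j + p < (size xi).-1)%N -> `|bspline xi p j x| <= 2 ^+ p.
  by move=> jp; have /andP[? ?] := bspline_bound x jp; rewrite ger0_norm.
apply: le_trans (ler_normD _ _) _; apply: lerD;
  apply: le_trans (ler_normD _ _) _; apply: lerD; rewrite normrM ?normrN.
- by rewrite ler_wpM2l // nb // ltnW.
- apply: le_trans (b1 x); have [->|] := eqVneq (dbspline p i x) 0.
    by rewrite normr0 mulr0.
  move=> /(dbspline_support (ltnW ip))/weights_bound[/andP[w0 w1] _].
  by rewrite ler_piMl // ger0_norm.
- by rewrite ler_wpM2l // nb.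
- apply: le_trans (b2 x); have [->|] := eqVneq (dbspline p i.+1 x) 0.
    by rewrite normr0 mulr0.
  move=> /(dbspline_support ip)/weights_bound[_ /andP[w0 w1]].
  by rewrite ler_piMl // ger0_norm.
Qed.

(** Spans are closed on the left, so degree 0 splines are constant just to the right of [x];
    strictly below the last knot the endpoint term drops out. The weights of the recursion are
    continuous. *)
Lemma bspline_right_continuous p i x : x < last 0 xi ->
  bspline xi p i y @[y --> x^'+] --> bspline xi p i x.
Proof.
move=> xl; elim: p i => [|p IH] i /=.
  have near_le a : \forall y \near x^'+, (a <= y) = (a <= x).
    case: (leP a x) => [ax|xa]; near=> y.
      by apply/idP; apply: le_trans ax _; exact: ltW.
    by apply/negbTE; rewrite -ltNge; near: y; exact: nbhs_right_lt.
  apply: cvg_near_cst; near=> y; congr (nat_of_bool _)%:R.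
  have -> : (y == last 0 xi) = (x == last 0 xi).
    by rewrite !lt_eqF //; near: y; exact: nbhs_right_lt.
  by congr (_ && _ || _); rewrite ?ltNge; [|congr (~~ _)]; near: y;
    exact: near_le.
have cx : y @[y --> x^'+] --> x by apply: cvg_at_right_filter; exact: cvg_id.
apply: cvgD; apply: cvgM => //; apply: cvgM; try exact: cvg_cst;
  by apply: cvgB => //; exact: cvg_cst.
Unshelve. all: by end_near.
Qed.

(** Off the knots degree 0 splines are locally constant; higher degrees follow by the product
    rule. *)
Lemma is_derive_bspline p i x : (i + p < (size xi).-1)%N -> x \notin xi ->
  is_derive x 1 (bspline xi p i) (dbspline p i x).
Proof.
move=> ip x_xi; elim: p i ip => [|p IH] i.
  rewrite addn0 => ip.
  have szxi : (0 < size xi)%N by move: ip; case: (size xi).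
  have nk j : (j < size xi)%N ->
      \forall y \near x, (xi`_j <= y) = (xi`_j <= x) /\ y != xi`_j.
    move=> jn; have : x != xi`_j.
      by apply: contra x_xi => /eqP ->; rewrite mem_nth.
    rewrite neq_lt => /orP[] xj; near=> y.
      have yj : y < xi`_j by near: y; exact: lt_nbhsl.
      by rewrite lt_eqF //= leNgt yj leNgt xj.
    have yj : xi`_j < y by near: y; exact: lt_nbhsr.
    by rewrite gt_eqF //= !ltW.
  apply: near_eq_is_derive (is_derive_cst (bspline xi 0 i x) x 1).
  have n1 := nk i (leq_trans ip (leq_pred _)).
  have n2 : \forall y \near x,
      (xi`_i.+1 <= y) = (xi`_i.+1 <= x) /\ y != xi`_i.+1.
    by apply: nk; move: ip; case: (size xi).
  (* The last knot is treated too, since the degree 0 spline tests for equality with it. *)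
  have n3 := nk (size xi).-1; rewrite ltn_predL in n3; have {}n3 := n3 szxi.
  near=> y; rewrite /cst /=; congr (nat_of_bool _)%:R.
  have [-> yi] : (xi`_i <= y) = (xi`_i <= x) /\ y != xi`_i by near: y.
  have : (xi`_i.+1 <= y) = (xi`_i.+1 <= x) /\ y != xi`_i.+1 by near: y.
  rewrite !ltNge => -[-> _]; congr (_ || [&& _, _ & _]).
  rewrite -nth_last; have [_ /negPf ->] :
    (xi`_(size xi).-1 <= y) = (xi`_(size xi).-1 <= x)
    /\ y != xi`_(size xi).-1 by near: y.
  by apply/negP => /eqP xe; move: x_xi; rewrite xe mem_nth ?ltn_predL.
rewrite addnS -addSn => ip.
have d1 := IH i (ltnW ip); have d2 := IH i.+1 ip.
rewrite (_ : bspline xi p.+1 i =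
    ((xi`_(i + p).+1 - xi`_i)^-1 \*: (id - cst xi`_i)) * bspline xi p i
  + ((xi`_(i.+1 + p).+1 - xi`_i.+1)^-1 \*: (cst xi`_(i.+1 + p).+1 - id))
    * bspline xi p i.+1); last first.
  apply/funext => y; rewrite bsplineS /=.
  by congr (_ * _ + _ * _); rewrite mulrC.
have dB (a : R) : is_derive x 1 (id - cst a : R -> R) (1 - 0).
  exact: is_deriveB.
have dN (a : R) : is_derive x 1 (cst a - id : R -> R) (0 - 1).
  exact: is_deriveB.
apply: is_derive_eq (is_deriveD (is_deriveM (is_deriveZ _ (dB _)) d1)
  (is_deriveM (is_deriveZ _ (dN _)) d2)) _.
rewrite /= subr0 sub0r /GRing.scale /= !mulr1.
rewrite !fctE /=; move: (_ - xi`_i)^-1 (_ - xi`_i.+1)^-1 => a b; ring.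
Unshelve. all: by end_near.
Qed.

End bspline_theory.

(** * Removing a null set from the domain of integration *)

Section null_sets.
Context d (T : measurableType d) (R : realType) (mu : {measure set T -> \bar R}).
Local Open Scope ereal_scope.
Import HBNNSimple.

(** The integral of a nonnegative function, measurable or not, is a supremum over simple functions
    below it. Multiplying one of these by the indicator of the complement of [N] keeps its integral
    and puts it below [f] on [D] minus [N]. *)
Let ge0_integral_setD_null (D N : set T) (f : T -> \bar R) :
  measurable N -> mu N = 0 -> (forall x, 0 <= f x) ->
  \int[mu]_(x in D) f x = \int[mu]_(x in D `\` N) f x.
Proof.
move=> mN N0 f0; rewrite !ge0_integralE //.
apply/eqP; rewrite eq_le; apply/andP; split; apply: ge_ereal_sup => _ [h hf <-];
  last first.
  apply: ereal_sup_ubound; exists h => // x; apply: le_trans (hf x) _.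
  rewrite /patch; case: ifPn => [|_]; last by case: ifP.
  by rewrite inE => -[xD _]; rewrite mem_set.
have mCN := measurableC mN.
have -> : sintegral mu h = sintegral mu (proj_nnsfun h mCN).
  rewrite -!integralT_nnsfun.
  rewrite (@ge0_negligible_integral _ _ _ mu setT N) //; first last.
  - by move=> x _; rewrite lee_fin; exact: fun_ge0.
  - exact/measurable_EFinP/measurable_funPT.
  rewrite [RHS](@ge0_negligible_integral _ _ _ mu setT N) //; first last.
  - by move=> x _; rewrite lee_fin; exact: fun_ge0.
  - exact/measurable_EFinP/measurable_funPT.
  apply: eq_integral => x; rewrite inE => -[_ xN].
  by rewrite /= mindicE mem_set //= mulr1.
apply: ereal_sup_ubound; exists (proj_nnsfun h mCN) => // x /=.
rewrite mindicE /patch.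
have [xN|xN] := boolP (x \in ~` N); rewrite /= ?mulr0 ?mulr1.
  have := hf x; rewrite /patch; case: ifPn => xD hx; last first.
    by apply: le_trans hx _; case: ifP.
  rewrite ifT // inE; split; first by rewrite inE in xD.
  by rewrite inE in xN.
by case: ifP.
Qed.

(* No measurability of [f] is required: this discards the points where a
   classical derivative does not exist and ['D_v] takes a junk value. *)
Lemma integral_setD_null (D N : set T) (f : T -> \bar R) :
  measurable N -> mu N = 0 ->
  \int[mu]_(x in D) f x = \int[mu]_(x in D `\` N) f x.
Proof.
move=> mN N0; rewrite integralE [RHS]integralE.
by congr (_ - _); exact: ge0_integral_setD_null.
Qed.

End null_sets.

(** * Lebesgue measure on row vectors: open sets and knot hyperplanes *)

Section row_measure.
Context (R : realType) (d : nat).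

Lemma measurable_row_box (A : 'I_d -> set (measurableTypeR R)) :
  (forall i, measurable (A i)) ->
  measurable [set x : 'rV[R]_d | forall i, A i (x ord0 i)].
Proof.
move=> mA; rewrite (_ : [set _ | _] = \bigcap_(i in [set: 'I_d])
    ((fun x : 'rV[R]_d => x ord0 i) @^-1` A i)); last first.
  by apply/seteqP; split=> [x /= Ax i _|x /= Ax i]; exact: Ax.
apply: fin_bigcap_measurable => // i _; rewrite -[X in measurable X]setTI.
by apply: (@measurable_coordinate R d i); [|exact: mA].
Qed.

(** The sigma-algebra is generated by the coordinates, so an open set is written as the countable
    union of the boxes with rational centre and radius that it contains. *)
Lemma open_measurable_row (O : set 'rV[R]_d) : open O -> measurable O.
Proof.
move=> oO.
pose box (c : 'rV[rat]_d * rat) : set 'rV[R]_d :=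
  [set x | forall i, ball (ratr (c.1 ord0 i) : R) (ratr c.2) (x ord0 i)].
pose F c : set 'rV[R]_d := if `[< box c `<=` O >] then box c else set0.
suff -> : O = \bigcup_c F c.
  apply: countable_bigcupT_measurable => [|c]; first exact: countableP.
  rewrite /F; case: ifP => // _.
  have := @measurable_row_box
    (fun i => ball (ratr (c.1 ord0 i) : R) (ratr c.2)).
  by apply => i; exact: measurable_ball.
apply/seteqP; split=> [x Ox|x [c _]]; last first.
  by rewrite /F; case: ifP => // /asboolP; apply.
have [e e0 xe] : exists2 e : R, 0 < e & ball x e `<=` O.
  have /nbhs_ballP[e e0 xe] := open_nbhs_nbhs (conj oO Ox); by exists e.
(* Two points of a box of radius [r] are closer than [2 r], hence the half of [e]. *)
have [r] : exists q : rat, (ratr q : R) \in `]0, (e / 2)[.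
  by apply: rat_in_itvoo; rewrite divr_gt0.
rewrite in_itv /= => /andP[r0 re].
have /(@boolp.choice 'I_d rat)[c cP] : forall i : 'I_d, exists q : rat,
    `|ratr q - x ord0 i| < ratr r.
  move=> i.
  have [q] : exists q : rat,
      (ratr q : R) \in `](x ord0 i - ratr r), (x ord0 i + ratr r)[.
    by apply: rat_in_itvoo; lra.
  by rewrite in_itv /= => qP; exists q; rewrite ltr_distl.
exists (\row_i c i, r) => //; rewrite /F.
have boxx : box (\row_i c i, r) x.
  by move=> i /=; rewrite mxE /ball /=; exact: cP.
rewrite ifT //; apply/asboolP => y yP; apply: xe; split => // i j.
rewrite ord1; have := yP j; have := boxx j; rewrite /ball /= => xb yb.
by apply: le_lt_trans (ler_distD (ratr ((\row_i c i) ord0 j)) _ _) _; 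
  rewrite distrC; lra.
Qed.

(** The knot hyperplanes, extended to the whole space: a null set off which every tensor B-spline
    has classical partial derivatives. *)
Definition mesh (xi : 'I_d -> seq R) : set 'rV[R]_d :=
  [set x | exists l, x ord0 l \in xi l].

Let countable_seq (s : seq R) : countable [set` s].
Proof. exact/finite_set_countable/finite_seq. Qed.

Let measurable_seq (s : seq R) : measurable ([set` s] : set (measurableTypeR R)).
Proof. by apply: countable_measurable => // t; exact: measurable_set1. Qed.

Lemma measurable_mesh xi : measurable (mesh xi).
Proof.
rewrite (_ : mesh xi = \bigcup_(l in [set: 'I_d])
    ((fun x : 'rV[R]_d => x ord0 l) @^-1` [set` xi l])); last first.
  by apply/seteqP; split=> x /= [l]; exists l.
apply: fin_bigcup_measurable => // l _; rewrite -[X in measurable X]setTI.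
by apply: (@measurable_coordinate R d l) => //; exact: measurable_seq.
Qed.

Lemma lebesgue_row_mesh xi : lebesgue_row R d (mesh xi) = 0%E.
Proof.
apply/negligibleP; first exact: measurable_mesh.
pose A l : set 'rV[R]_d := [set x | x ord0 l \in xi l].
apply: (@negligibleS _ _ _ _ (\big[setU/set0]_l A l)).
  move=> x [l xl]; rewrite -bigcup_seq.
  by exists l => //=; rewrite mem_index_enum.
apply: big_ind => [||l _]; [exact: negligible_set0|exact: negligibleU|].
(* The hyperplanes orthogonal to direction [l] form a box with one countable side, and [0 * +oo = 0]
   absorbs its infinite sides. *)
pose B m : set (measurableTypeR R) := if m == l then [set` xi l] else setT.
have mB m : measurable (B m).
  by rewrite /B; case: eqP => // _; exact: measurable_seq.
have -> : A l = [set x | forall i, B i (x ord0 i)].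
  apply/seteqP; split=> [x xl i|x /(_ l)]; last by rewrite /B eqxx.
  by rewrite /B; case: eqP => // ->.
apply/negligibleP; first exact: measurable_row_box.
apply: etrans (lebesgue_row_box mB) _; rewrite (bigD1 l) //= /B eqxx.
by rewrite countable_lebesgue_measure0 ?mul0e.
Qed.

End row_measure.

(** * Tensor-product B-splines and their gradients *)

Section tensor_bspline_theory.
Context (R : realType) (d : nat) (p : 'I_d -> nat) (xi : 'I_d -> seq R).
Implicit Types (i j : multi_index p xi) (x : 'rV[R]_d).
Hypothesis xi_sorted : forall l, sorted <=%R (xi l).

Lemma multi_index_lt i l : (i l + p l < (size (xi l)).-1)%N.
Proof.
have := ltn_ord (i l); rewrite /nb_bsplines ltn_subRL addSn => ipn.
by rewrite -ltnS (ltn_predK ipn) addnC.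
Qed.

Lemma tensor_bspline_ge0 i x : 0 <= tensor_bspline i x.
Proof.
apply: prodr_ge0 => l _.
by have /andP[] := bspline_bound (xi_sorted l) (x ord0 l) (multi_index_lt i l).
Qed.

(* The partial derivative of [tensor_bspline i] in direction [l], off the mesh
   lines. *)
Definition dtensor i l x : R := \prod_m
  (if m == l then dbspline (xi m) (p m) (i m) (x ord0 m)
   else bspline (xi m) (p m) (i m) (x ord0 m)).

(** A function defined everywhere, measurable and bounded, that agrees off the mesh with the
    integrand of [energy]. *)
Definition grad_dot i j x : R := \sum_l dtensor i l x * dtensor j l x.

Lemma grad_tensor_bspline i x : ~ mesh xi x ->
  grad (tensor_bspline i) x = \row_l dtensor i l x.
Proof.
move=> xN; apply/rowP => l; rewrite !mxE.
pose P := \prod_(m < d | m != l) bspline (xi m) (p m) (i m) (x ord0 m).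
have d1 : is_derive (x ord0 l) 1 (P \*: (bspline (xi l) (p l) (i l) : R -> R))
    (P *: dbspline (xi l) (p l) (i l) (x ord0 l)).
  apply: is_deriveZ; apply: (is_derive_bspline (multi_index_lt i l)).
  by apply/negP => xl; apply: xN; exists l.
(* Moving [x] in direction [l] changes one factor only, so the two difference quotients coincide. *)
transitivity ('D_1 (P \*: (bspline (xi l) (p l) (i l) : R -> R)) (x ord0 l)).
  rewrite /derive.
  have -> // : (fun h : R => h^-1 *: ((tensor_bspline i \o shift x)
        (h *: delta_mx ord0 l) - tensor_bspline i x)) =
      (fun h : R => h^-1 *: (((P \*: (bspline (xi l) (p l) (i l) : R -> R)) \o
        shift (x ord0 l)) (h *: 1)
        - (P \*: (bspline (xi l) (p l) (i l) : R -> R)) (x ord0 l))).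
  apply/funext => h /=; congr (_ *: _).
  rewrite /tensor_bspline (bigD1 l) //= [in X in _ - X](bigD1 l) //=.
  rewrite !mxE !eqxx mulrC [X in _ - X]mulrC; congr (_ * _ - _).
  by apply: eq_bigr => m ml; rewrite !mxE (negPf ml) andbF mulr0 add0r.
rewrite derive_val /dtensor (bigD1 l) //= eqxx mulrC; congr (_ * _).
by apply: eq_bigr => m /negPf ->.
Qed.

Lemma grad_dotE i j x : ~ mesh xi x ->
  (grad (tensor_bspline i) x *m (grad (tensor_bspline j) x)^T) ord0 ord0 =
  grad_dot i j x.
Proof.
move=> xN; rewrite !grad_tensor_bspline // mxE.
by apply: eq_bigr => l _; rewrite !mxE.
Qed.

Let measurable_coord_comp (f : R -> R) l : measurable_fun setT f ->
  measurable_fun setT (fun x : 'rV[R]_d => f (x ord0 l)).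
Proof.
by move=> mf; apply: measurableT_comp => //; exact: measurable_coordinate.
Qed.

Lemma measurable_tensor_bspline i : measurable_fun setT (tensor_bspline i).
Proof.
apply: measurable_prod => l _; apply: measurable_coord_comp.
exact: measurable_bspline.
Qed.

Lemma measurable_dtensor i l : measurable_fun setT (dtensor i l).
Proof.
apply: measurable_prod => m _; case: eqP => _; apply: measurable_coord_comp.
  exact: measurable_dbspline.
exact: measurable_bspline.
Qed.

Lemma measurable_grad_dot i j : measurable_fun setT (grad_dot i j).
Proof.
by apply: measurable_sum => l; apply: measurable_funM; exact: measurable_dtensor.
Qed.

Let bounded_prod T (F : 'I_d -> T -> R) :
  (forall m, exists M, forall t, `|F m t| <= M) ->
  exists M, forall t, `|\prod_m F m t| <= M.
Proof.
move=> /(@boolp.choice 'I_d R)[M MP]; exists (\prod_m M m) => x.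
by rewrite normr_prod; apply: ler_prod => m _; rewrite normr_ge0 MP.
Qed.

Let bounded_bspline i l :
  exists M, forall x, `|bspline (xi l) (p l) (i l) (x ord0 l)| <= M.
Proof.
exists (2 ^+ p l) => x.
have /andP[b0 b1] :=
  bspline_bound (xi_sorted l) (x ord0 l) (multi_index_lt i l).
by rewrite ger0_norm.
Qed.

Lemma tensor_bspline_bounded i : exists M, forall x, `|tensor_bspline i x| <= M.
Proof. by apply: bounded_prod => l; exact: bounded_bspline. Qed.

Lemma dtensor_bounded i l : exists M, forall x, `|dtensor i l x| <= M.
Proof.
apply: bounded_prod => m; case: eqP => _; last exact: bounded_bspline.
have [M MP] := dbspline_bound (xi_sorted m) (multi_index_lt i m).
by exists M => x; exact: MP.
Qed.

Lemma grad_dot_bounded i j : exists M, forall x, `|grad_dot i j x| <= M.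
Proof.
have /(@boolp.choice 'I_d R)[M MP] := dtensor_bounded i.
have /(@boolp.choice 'I_d R)[N NP] := dtensor_bounded j.
exists (\sum_l M l * N l) => x; apply: le_trans (ler_norm_sum _ _ _) _.
by apply: ler_sum => l _; rewrite normrM ler_pM.
Qed.

(** Off the mesh no coordinate is a knot, so the closed support intervals become open; this
    separates supports that share only a knot. *)
Lemma dtensor_support i l m x : ~ mesh xi x -> dtensor i l x != 0 ->
  (xi m)`_(i m) < x ord0 m < (xi m)`_(i m + p m).+1.
Proof.
move=> xN /prodf_neq0/(_ m isT) im.
have ipm := multi_index_lt i m.
have size_gt : ((i m + p m).+1 < size (xi m))%N.
  by move: ipm; case: (size (xi m)).
have neq k : (k < size (xi m))%N -> (xi m)`_k != x ord0 m.
  by move=> km; apply/eqP => kx; apply: xN; exists m; rewrite -kx mem_nth.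
have : (xi m)`_(i m) <= x ord0 m <= (xi m)`_(i m + p m).+1.
  move: im; case: (m == l); first exact: (dbspline_support (xi_sorted m) ipm).
  exact: (bspline_support (xi_sorted m) ipm).
have lt1 : (i m < size (xi m))%N.
  by apply: leq_ltn_trans size_gt; apply: leq_trans (leqnSn _); exact: leq_addr.
by rewrite !lt_neqAle neq // [x _ _ == _]eq_sym neq.
Qed.

(** In direction [m] the support of [i] ends no later than that of [j] begins, and every term of the
    sum contains a factor of each spline in that direction. *)
Lemma grad_dot_eq0 i j m x : (i m + p m < j m)%N -> ~ mesh xi x ->
  grad_dot i j x = 0.
Proof.
move=> ij xN; apply: big1 => l _.
have [->|di] := eqVneq (dtensor i l x) 0; first by rewrite mul0r.
have [->|dj] := eqVneq (dtensor j l x) 0; first by rewrite mulr0.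
have /andP[_ xi_lt] := dtensor_support m xN di.
have /andP[lt_xj _] := dtensor_support m xN dj.
have jm : (j m < size (xi m))%N.
  have := multi_index_lt j m; rewrite ltn_predRL; apply: leq_trans.
  by rewrite ltnS ltnW // ltnS leq_addr.
have := lt_trans lt_xj xi_lt; rewrite ltNge; case/negP.
exact: knot_le.
Qed.

Lemma grad_dotC i j x : grad_dot i j x = grad_dot j i x.
Proof. by apply: eq_bigr => l _; rewrite mulrC. Qed.

(** Right continuity of the factors spreads nonvanishing at [x] to a box with lower corner [x], a
    set of positive measure inside [O]. *)
Lemma tensor_bspline_neq0_box (O : set 'rV[R]_d) i x :
  open O -> O x -> (forall l, x ord0 l < last 0 (xi l)) ->
  tensor_bspline i x != 0 ->
  exists2 e : R, 0 < e & forall y : 'rV[R]_d,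
    (forall l, `]x ord0 l, (x ord0 l + e)[%classic (y ord0 l)) ->
    O y /\ tensor_bspline i y != 0.
Proof.
move=> oO Ox xl /prodf_neq0 bx.
have [e e0 xe] : exists2 e : R, 0 < e & ball x e `<=` O.
  have /nbhs_ballP[e e0 xe] := open_nbhs_nbhs (conj oO Ox); by exists e.
have : \forall h \near 0^'+, forall l,
    bspline (xi l) (p l) (i l) (x ord0 l + h) != 0.
  apply: filter_forall => l; have bl := bx l isT.
  apply/(@nbhs_right0P R (x ord0 l)
    (fun y => bspline (xi l) (p l) (i l) y != 0)).
  have bc := @bspline_right_continuous R (xi l) (p l) (i l) _ (xl l).
  have := cvgr_norm_gt _ bc 0.
  by rewrite normr_gt0 => /(_ _ bl); apply: filterS => y; rewrite normr_gt0.
move=> /nbhs_ballP[r /= r0 rP].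
exists (Num.min e r); first by rewrite lt_min e0.
move=> y yP; split.
  apply: xe; split => // a l; rewrite ord1 /ball /=.
  have := yP l; rewrite /= in_itv /= => /andP[y1 y2].
  rewrite distrC gtr0_norm ?subr_gt0 // ltrBlDl (lt_le_trans y2) // lerD2l.
  by rewrite ge_min lexx.
apply/prodf_neq0 => l _; have := yP l; rewrite /= in_itv /= => /andP[y1 y2].
have := rP (y ord0 l - x ord0 l); rewrite /ball /= sub0r normrN.
rewrite gtr0_norm ?subr_gt0 // => /(_ _ y1 l); rewrite subrKC; apply.
by rewrite ltrBlDl (lt_le_trans y2) // lerD2l ge_min lexx orbT.
Qed.

End tensor_bspline_theory.

(** * Stiffness and lumped mass entries as integrals over the domain *)

Section discrete_forms.
Context (R : realType) (d : nat) (p : 'I_d -> nat) (xi : 'I_d -> seq R).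
Context (Omega GammaD : set 'rV[R]_d).
Implicit Types (i j : multi_index p xi).
Hypothesis xi_sorted : forall l, sorted <=%R (xi l).
Hypothesis xi_lt : forall l, head 0 (xi l) < last 0 (xi l).
Hypothesis Omega_open : open Omega.
Hypothesis Omega_sub : Omega `<=` fictitious_domain xi.
Local Notation mu := (lebesgue_row R d).

Let mOmega : measurable Omega.
Proof. exact: open_measurable_row. Qed.

Lemma lebesgue_row_domain : (mu Omega < +oo)%E.
Proof.
pose B l : set (measurableTypeR R) := `]head 0 (xi l), last 0 (xi l)[%classic.
have mB l : measurable (B l) by exact: measurable_itv.
apply: (@le_lt_trans _ _ (mu [set x | forall l, B l (x ord0 l)])).
  apply: le_measure; rewrite ?inE //; exact: measurable_row_box.
rewrite lebesgue_row_box // -ge0_fin_numE; last by apply: prode_ge0.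
apply: prode_fin_num => l _; rewrite /B lebesgue_measure_itv /= lte_fin xi_lt.
by rewrite -EFinD.
Qed.

Lemma integrable_bounded (D : set 'rV[R]_d) (f : 'rV[R]_d -> R) :
  measurable D -> D `<=` Omega -> measurable_fun setT f ->
  (exists M, forall x, `|f x| <= M) -> mu.-integrable D (EFin \o f).
Proof.
move=> mD DO mf [M fM]; apply: measurable_bounded_integrable => //.
- apply: le_lt_trans lebesgue_row_domain; apply: le_measure; rewrite ?inE //.
- exact: measurable_funS mf.
- exists M; split; first exact: num_real.
  by move=> N MN x _; apply: le_trans (fM x) _; exact: ltW.
Qed.

Let D := Omega `\` mesh xi.

Let mD : measurable D.
Proof. by apply: measurableD => //; exact: measurable_mesh. Qed.

(** The mesh is null, hence can be removed, and what remains is an integrand known to be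
    integrable. *)
Lemma energyE i j :
  energy Omega (tensor_bspline i) (tensor_bspline j) =
  \int[mu]_(x in D) grad_dot i j x.
Proof.
rewrite /energy /Rintegral.
rewrite (@integral_setD_null _ _ _ _ _ (mesh xi)); first last.
- exact: lebesgue_row_mesh.
- exact: measurable_mesh.
congr fine; apply: eq_integral => x; rewrite inE => -[_ xN].
by rewrite grad_dotE.
Qed.

Let integrable_grad_dot i j : mu.-integrable D (EFin \o grad_dot i j).
Proof.
apply: integrable_bounded => //; first by move=> x [].
  exact: measurable_grad_dot.
exact: grad_dot_bounded.
Qed.

Lemma energyC i j :
  energy Omega (tensor_bspline i) (tensor_bspline j) =
  energy Omega (tensor_bspline j) (tensor_bspline i).
Proof.
by rewrite !energyE; apply: eq_Rintegral => x _; rewrite grad_dotC.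
Qed.

(** Off the mesh the integrand is the squared norm of [s] times the gradient of spline [i] plus [t]
    times that of spline [j]. *)
Lemma energy_quadratic_ge0 i j (s t : R) :
  0 <= s ^+ 2 * energy Omega (tensor_bspline i) (tensor_bspline i)
    + (s * t * energy Omega (tensor_bspline i) (tensor_bspline j)) *+ 2
    + t ^+ 2 * energy Omega (tensor_bspline j) (tensor_bspline j).
Proof.
have iZ r a b :
    mu.-integrable D (EFin \o (fun x => r * @grad_dot R d p xi a b x)).
  rewrite (_ : _ \o _ = (fun x => r%:E * (EFin \o grad_dot a b) x)%E).
    exact: integrableZl.
  by apply/funext.
have iD (f g : 'rV[R]_d -> R) : mu.-integrable D (EFin \o f) ->
    mu.-integrable D (EFin \o g) ->
    mu.-integrable D (EFin \o (fun x => f x + g x)).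
  move=> intf intg; rewrite (_ : _ \o _ = ((EFin \o f) \+ (EFin \o g))%E).
    exact: integrableD.
  by apply/funext.
rewrite -mulrnAl !energyE -!RintegralZl // -RintegralD // -RintegralD //.
  apply: Rintegral_ge0 => x _; rewrite !mulr_sumr -!big_split /=.
  apply: sumr_ge0 => l _.
  rewrite (_ : _ + _ = (s * dtensor i l x + t * dtensor j l x) ^+ 2) ?sqr_ge0 //.
  ring.
exact: iD.
Qed.

Lemma energy_eq0 i j m : (i m + p m < j m)%N ->
  energy Omega (tensor_bspline i) (tensor_bspline j) = 0.
Proof.
move=> ij; rewrite energyE (@eq_Rintegral _ _ _ _ _ (cst 0)); last first.
  by move=> x; rewrite inE => -[_ xN]; exact: (grad_dot_eq0 xi_sorted ij).
by rewrite /Rintegral integral0.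
Qed.

(** If the integral vanished, the square would be 0 almost everywhere on [Omega], against a box of
    measure [e ^+ d] on which the spline is nonzero. *)
Lemma Rintegral_tensor_bspline_sqr_gt0 i : touches Omega i ->
  0 < \int[mu]_(x in Omega) (tensor_bspline i x * tensor_bspline i x).
Proof.
move=> [x [cx Ox]].
(* [Omega] is open, so meeting the closure of the nonzero set it meets the set itself. *)
have [y [by0 Oy]] : [set x | tensor_bspline i x != 0] `&` Omega !=set0.
  by apply: cx; exact: open_nbhs_nbhs.
have [|e e0 eP] := tensor_bspline_neq0_box Omega_open Oy _ by0.
  by move=> l; have /andP[] := Omega_sub Oy l.
pose f x := tensor_bspline i x * tensor_bspline i x.
have f0 z : 0 <= f z by exact: sqr_ge0.
have mf : measurable_fun setT f.
  by apply: measurable_funM; exact: measurable_tensor_bspline.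
have : 0 <= \int[mu]_(x in Omega) f x by apply: Rintegral_ge0.
rewrite le_eqVlt => /orP[/eqP int0|//]; exfalso.
pose B l : set (measurableTypeR R) := `]y ord0 l, (y ord0 l + e)[%classic.
have mB l : measurable (B l) by exact: measurable_itv.
have intf : mu.-integrable Omega (EFin \o f).
  apply: integrable_bounded => //.
  have [M fM] := tensor_bspline_bounded xi_sorted i.
  by exists (M * M) => z; rewrite normrM ler_pM.
have : ae_eq mu Omega (EFin \o f) (cst 0%E).
  apply/(ae_eq_integral_abs mu mOmega).
    by apply/measurable_EFinP; exact: measurable_funS mf.
  rewrite (eq_integral (EFin \o f)) => [|z _]; last by rewrite /= ger0_norm.
  rewrite -[LHS]fineK; last exact: integrable_fin_num.
  by congr EFin; rewrite int0.
rewrite /ae_eq /almost_everywhere => fN.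
have : mu.-negligible [set z | forall l, B l (z ord0 l)].
  apply: negligibleS fN => z zB /=.
  have [Oz bz] := eP z zB; move=> /(_ Oz) /= [].
  by apply/eqP; rewrite mulf_neq0.
move/negligibleP => /(_ (measurable_row_box mB)).
move: (lebesgue_row_box mB) => /[swap] -> /esym/eqP; apply/negP.
rewrite (eq_bigr (fun=> e%:E)); last first.
  move=> l _; rewrite /B lebesgue_measure_itv /= lte_fin ltrDl e0 -EFinD.
  by rewrite addrC addKr.
by rewrite prodEFin eqe prodr_const expf_eq0 gt_eqF // andbF.
Qed.

Local Notation phi := (@phi R d p xi Omega GammaD).
Local Notation K := (stiffness p xi Omega GammaD).

Lemma active_indexP (k : 'I_(nb_active p xi Omega GammaD)) :
  active Omega GammaD (active_index k).
Proof. by have := enum_valP k; rewrite inE => /asboolP. Qed.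

(** All terms of the row sum are nonnegative, and the diagonal one is the integral of the square of
    a spline touching [Omega]. *)
Lemma lumped_entry_gt0 (k : 'I_(nb_active p xi Omega GammaD)) :
  0 < lumped_entry k.
Proof.
have [touch _] := active_indexP k.
rewrite /lumped_entry (bigD1 (active_index k)) ?asboolT //=.
rewrite ltr_pwDl ?Rintegral_tensor_bspline_sqr_gt0 //.
apply: sumr_ge0 => j _; apply: Rintegral_ge0 => x _.
by rewrite mulr_ge0 // tensor_bspline_ge0.
Qed.

Lemma stiffness_sym : K^T = K.
Proof. by apply/matrixP => k m; rewrite !mxE energyC. Qed.

Lemma stiffness_row_card k :
  (#|[pred m | K k m != 0%R]| <= \prod_(l < d) (2 * p l + 1))%N.
Proof.
pose i := active_index k.
pose near l :=
  [pred a : 'I_(nb_bsplines (p l) (xi l)) |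
    (i l <= a + p l)%N && (a <= i l + p l)%N].
have inj_index : injective (@active_index R d p xi Omega GammaD).
  exact: enum_val_inj.
rewrite -(fintype.card_image inj_index).
(* Distinct active indices have distinct multi-indices, so the nonzero entries are counted inside a
   product of index windows. *)
apply: (@leq_trans #|(family near : simpl_pred (multi_index p xi))|).
  apply/subset_leq_card/fintype.subsetP => _ /fintype.imageP[m Kkm ->].
  apply/familyP => l; rewrite inE /= (leqNgt (i l)) (leqNgt (active_index m l)).
  rewrite -negb_or; apply: contra Kkm; rewrite mxE => /orP[] lt_l.
    by rewrite energyC (energy_eq0 lt_l).
  by rewrite (energy_eq0 lt_l).
have near_card l : (#|near l| <= 2 * p l + 1)%N.
  (* Truncated subtraction is harmless: if [i l < p l] the list starts at 0 and still reaches
     [i l + p l]. *)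
  rewrite cardE -(size_map val) -[leqRHS](size_iota (i l - p l)).
  apply: uniq_leq_size.
    by rewrite map_inj_uniq ?enum_uniq //; exact: val_inj.
  move=> _ /mapP[a + ->]; rewrite mem_enum mem_iota inE /=; lia.
rewrite card_family foldrE big_image; apply: leq_prod => l _; exact: near_card.
Qed.

Lemma Rhat_basisE k :
  @Rhat_basis R d p xi Omega GammaD k = K k k / lumped_entry k.
Proof.
rewrite /Rhat_basis /Rhat.
have -> : spline (delta_mx k ord0) = phi k.
  apply/funext => x; rewrite /spline (bigD1 k) //= mxE !eqxx mul1r.
  by rewrite big1 ?addr0 // => m /negPf mk; rewrite mxE mk mul0r.
rewrite mxE; congr (_ / _).
by rewrite /bhat trmx_delta -rowE -colE !mxE eqxx mulr1n.
Qed.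

End discrete_forms.

(** * Extreme eigenvalues against the Rayleigh quotients of the basis *)

Theorem corollary3p3 (R : realType) :
  exists c : forall d : nat, ('I_d -> nat) -> R,
    (forall (d : nat) (p : 'I_d -> nat),
       c d p <= (\prod_(k < d) (2 * p k + 1))%:R) /\
    forall (d : nat) (p : 'I_d -> nat) (xi : 'I_d -> seq R)
           (Omega GammaD GammaN : set 'rV[R]_d),
      (0 < d)%N ->
      (forall l, (0 < p l)%N) ->
      (forall l, open_knot_vector (p l) (xi l)) ->
      open Omega -> connected Omega -> lipschitz_boundary Omega ->
      boundary Omega = closure (GammaD `|` GammaN) ->
      GammaD `&` GammaN = set0 ->
      GammaD !=set0 ->
      Omega `<=` fictitious_domain xi ->
      GammaD `<=` boundary (fictitious_domain xi) ->
      forall k0 : 'I_(nb_active p xi Omega GammaD),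
      let K := stiffness p xi Omega GammaD in
      let M := lumped_mass p xi Omega GammaD in
      let rho := @Rhat_basis R d p xi Omega GammaD in
      exists2 lam : (nb_active p xi Omega GammaD).-tuple R,
        ordered_gen_eigenvalues K M lam &
        [/\ head 0 lam <= \big[Num.min/rho k0]_k rho k,
            \big[Num.max/rho k0]_k rho k <= last 0 lam
          & last 0 lam <= c d p * \big[Num.max/rho k0]_k rho k].
Proof.
(* The product bound itself is taken as the constant. *)
exists (fun d p => (\prod_(k < d) (2 * p k + 1))%:R); split => //.
move=> d p xi Omega GammaD GammaN _ _ xi_open oO _ _ _ _ _ O_sub _ k0 K M rho.
have xi_sorted l : sorted <=%R (xi l) by have [] := xi_open l.
have xi_lt l : head 0 (xi l) < last 0 (xi l) by have [] := xi_open l.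
pose m : 'rV[R]_(nb_active p xi Omega GammaD) := \row_k lumped_entry k.
have m0 k : 0 < m ord0 k by rewrite mxE lumped_entry_gt0.
have Ksym : K^T = K by exact: stiffness_sym.
have rhoE k : rho k = K k k / m ord0 k.
  by rewrite [m _ _]mxE; exact: Rhat_basisE.
have [lam lamP lam_bnd] := gen_symmetric_spectrum Ksym m0.
have {}lam_bnd k : head 0 lam <= rho k <= last 0 lam by rewrite rhoE.
exists lam => //; split.
- apply: le_bigmin => [|k _]; first by have /andP[] := lam_bnd k0.
  by have /andP[] := lam_bnd k.
- apply: bigmax_le => [|k _]; first by have /andP[] := lam_bnd k0.
  by have /andP[] := lam_bnd k.
have [_ lam_eigen _] := lamP.
apply: (gen_eigenvalue_le Ksym _ _ m0); last 2 first.
- move=> k; rewrite -ler_pdivrMr // -rhoE; exact: le_bigmax.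
(* The index [k0] makes the tuple nonempty, so its last entry is an eigenvalue and not the default
   0. *)
- apply/lam_eigen; rewrite -nth_last mem_nth // size_tuple ltn_predL.
  exact: leq_ltn_trans (ltn_ord k0).
- by move=> i j s t; rewrite !mxE; exact: energy_quadratic_ge0.
- by move=> k; exact: stiffness_row_card.
Qed.
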